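(* Let $(G,R)$ be a finite rooted graph without sinks such that $t^{-1}(R)=\emptyset$ and $|o^{-1}(R)|>2$. If the unfolding tree $\mathcal{T}(G,R)$ is cocompact, then $(G,R)$ admits an actual labelling.
   Context: A graph $G=(VG,EG,o,t)$ is a directed multigraph (loops and multiple edges allowed) with origin and terminus maps $o,t:EG\to VG$. A sink is a vertex $v$ with $o^{-1}(v)=\emptyset$. A path is either an empty path $\varepsilon_v$ or a finite sequence $e_1\cdots e_n$ of edges with $t(e_i)=o(e_{i+1})$; $O(p),T(p)$ denote its origin and terminus. A rooted graph $(G,R)$ is a graph with a vertex $R$ from which every vertex is reachable by a directed path. A rooted tree is a graph with a vertex $R$ such that every vertex has a unique path from $R$. The unfolding tree $\mathcal{T}(G,R)$ has as vertices the paths $p$ with $O(p)=R$ and an edge $(p,pe)$ from $p$ to $pe$ for each such $p$ and each edge $e$ with $o(e)=T(p)$. For a rooted tree $\mathcal{T}$ with root $R$ and vertex $v$, $\mathcal{T}^v$ is obtained by reversing every edge on the path from $R$ to $v$. $\cong$ is isomorphism of directed graphs. A rooted tree $\mathcal{T}$ is cocompact if there are a finite set $F$ and $l:V\mathcal{T}\to F$ with $l(v)=l(w)\Rightarrow \mathcal{T}^v\cong\mathcal{T}^w$. Multisets over $X$ have positive integer multiplicities; union adds multiplicities; $M\setminus\{x\}$ removes one copy. $t_m(o^{-1}(v))$ is the multiset of termini of edges leaving $v$ counted with the number of edges; $l(t_m(o^{-1}(v)))$ its multiset of labels. Actual labelling of $(G,R)$ with $t^{-1}(R)=\emptyset$: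 a finite set $X$, maps $l:VG\to X$, $l_p:VG\setminus\{R\}\to X$, and multisets $M_x$ over $X$ ($x\in X$) such that for every $v\ne R$: (1) $l_p(v)\in M_{l(v)}$; (2) $l(t_m(o^{-1}(v)))=M_{l(v)}\setminus\{l_p(v)\}$; (3) $l(o(e))=l_p(v)$ for every edge $e$ with $t(e)=v$; and (4) $l(t_m(o^{-1}(R)))=M_{l(R)}$. *)

(* Defs.v *)
From HB Require Import structures.
From mathcomp Require Import all_boot.
From mathcomp Require Import finmap multiset.

Set Implicit Arguments.
Unset Strict Implicit.
Unset Printing Implicit Defensive.

Local Open Scope mset_scope.

(* Vertices and edges live in choiceTypes, not necessarily finite ones, so that
   unfolding trees are graphs too. *)
Record graph := Graph {
  VG : choiceType;
  EG : choiceType;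
  orig : EG -> VG;
  term : EG -> VG }.

Definition graph_iso (G H : graph) : Prop :=
  exists (f : VG G -> VG H) (g : EG G -> EG H),
    [/\ bijective f, bijective g,
        (forall e, orig (g e) = f (orig e)) &
        (forall e, term (g e) = f (term e))].

Section Paths.

Variable G : graph.
Implicit Types (v w : VG G) (e : EG G) (p : seq (EG G)).

(* A path is given by its origin v and its sequence of edges; [::] read at v is
   the empty path at v. *)
Fixpoint is_path v p : bool :=
  if p is e :: p' then (orig e == v) && is_path (term e) p' else true.

Definition terminus v p : VG G := last v [seq term e | e <- p].

Definition path_to v w p : bool := is_path v p && (terminus v p == w).

Definition rooted (R : VG G) : Prop := forall v, exists p, path_to R v p.

Definition tree_from (R : VG G) : Prop := forall v, exists! p, path_to R v p.

Definition sinkless : Prop := forall v, exists e, orig e = v.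

Lemma terminus_cat v p q : terminus v (p ++ q) = terminus (terminus v p) q.
Proof. by rewrite /terminus map_cat last_cat. Qed.

Lemma is_path_cat v p q :
  is_path v (p ++ q) = is_path v p && is_path (terminus v p) q.
Proof. by elim: p v => //= e p IHp v; rewrite IHp andbA. Qed.

Lemma is_path_rcons v p e :
  is_path v (rcons p e) = is_path v p && (orig e == terminus v p).
Proof. by rewrite -cats1 is_path_cat /= andbT. Qed.

End Paths.

Record rooted_tree := RootedTree {
  tree_graph :> graph;
  root : VG tree_graph;
  treeP : tree_from root }.

Section Trees.

Variable T : rooted_tree.
Implicit Types v w : VG T.

Lemma root_path_exists v : exists p, path_to (root T) v p.
Proof. by have [p [Hp _]] := treeP v; exists p. Qed.

Definition root_path v : seq (EG T) := xchoose (root_path_exists v).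

(* The directed graph T^v. *)
Definition reverse_to v : graph :=
  @Graph (VG T) (EG T)
    (fun e => if e \in root_path v then term e else orig e)
    (fun e => if e \in root_path v then orig e else term e).

Definition cocompact : Prop :=
  exists (F : finType) (l : VG T -> F),
    forall v w, l v = l w -> graph_iso (reverse_to v) (reverse_to w).

End Trees.

Section Unfolding.

Variables (G : graph) (R : VG G).

Definition unf_vertex : choiceType := {p : seq (EG G) | is_path R p}.

Definition unf_edge : choiceType :=
  {pe : unf_vertex * EG G | orig pe.2 == terminus R (val pe.1)}.

Definition unf_orig (x : unf_edge) : unf_vertex := (val x).1.

Lemma unf_term_proof (x : unf_edge) :
  is_path R (rcons (val (val x).1) (val x).2).
Proof. by rewrite is_path_rcons (valP (val x).1) (valP x). Qed.

Definition unf_term (x : unf_edge) : unf_vertex := Sub _ (unf_term_proof x).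

Definition unf_graph : graph := Graph unf_orig unf_term.

Definition unf_root : unf_vertex := Sub [::] isT.

Lemma unf_terminus (v : VG unf_graph) (s : seq (EG unf_graph)) :
  is_path v s -> val (terminus v s) = val v ++ [seq (val x).2 | x <- s].
Proof.
elim: s v => [|x s IHs] v /=; first by rewrite cats0.
by case/andP=> /eqP <- /IHs; rewrite /terminus /= => ->; rewrite -cats1 -catA.
Qed.

Lemma unf_path_inj (v : VG unf_graph) (s s' : seq (EG unf_graph)) :
  is_path v s -> is_path v s' ->
  [seq (val x).2 | x <- s] = [seq (val x).2 | x <- s'] -> s = s'.
Proof.
elim: s s' v => [|x s IHs] [|x' s'] v //= /andP[/eqP ox ps] /andP[/eqP ox' ps'].
case=> e_x e_s; have Dx : x = x'.
  apply: val_inj; rewrite [LHS]surjective_pairing [RHS]surjective_pairing e_x.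
  by congr (_, _); rewrite -[RHS]/(unf_orig x') -[LHS]/(unf_orig x) ox ox'.
by rewrite -Dx in ps' *; congr (_ :: _); apply: IHs ps ps' e_s.
Qed.

Lemma unf_tree_from : @tree_from unf_graph unf_root.
Proof.
move=> [p Rp]; have [s Hs]: exists s, @path_to unf_graph unf_root (Sub p Rp) s.
  elim/last_ind: p Rp => [|p e IHp] Rpe.
    by exists [::]; apply/eqP/val_inj.
  have := Rpe; rewrite is_path_rcons => /andP[Rp pe].
  have [s /andP[ps /eqP ts]] := IHp Rp.
  pose x : EG unf_graph := Sub (Sub p Rp : unf_vertex, e) pe.
  exists (rcons s x); rewrite /path_to is_path_rcons ps ts eqxx /=.
  by rewrite -cats1 terminus_cat; apply/eqP/val_inj.
exists s; split=> // s' /andP[ps' /eqP ts']; have /andP[ps /eqP ts] := Hs.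
apply: (unf_path_inj ps ps').
by have := unf_terminus ps; have := unf_terminus ps'; rewrite ts ts' /= => <- <-.
Qed.

Definition unfolding : rooted_tree := RootedTree unf_tree_from.

End Unfolding.

Definition mset_map (A B : choiceType) (f : A -> B) (M : {mset A}) : {mset B} :=
  seq_mset [seq f x | x <- M].

Section Labelling.

Variables (V E : finType) (o t : E -> V) (R : V).

Definition out_edges (v : V) : {set E} := [set e | o e == v].

(* t_m(o^{-1}(v)): one copy of t e for each edge e leaving v. *)
Definition out_neighbours (v : V) : {mset V} :=
  seq_mset [seq t e | e <- enum (out_edges v)].

Definition actual_labelling (X : finType) (l : V -> X)
    (lp : {v : V | v != R} -> X) (M : X -> {mset X}) : Prop :=
  (forall v : {v : V | v != R},
     [/\ lp v \in M (l (val v)),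
         mset_map l (out_neighbours (val v)) = M (l (val v)) `\ lp v &
         forall e, t e = val v -> l (o e) = lp v])
  /\ mset_map l (out_neighbours R) = M (l R).

Definition admits_actual_labelling : Prop :=
  exists (X : finType) (l : V -> X) (lp : {v : V | v != R} -> X)
         (M : X -> {mset X}), actual_labelling l lp M.

End Labelling.

(* Main.v *)
(* Adjacency in the unfolding tree T, forgetting orientations, is refined by
   colouring vertices iteratively: two vertices get the same colour at step n + 1
   if they do at step n and the multisets of step-n colours of their neighbours
   agree. An isomorphism between T^v and T^w preserves all these colours, so
   cocompactness forces them to stabilise at some step N; then the colour of a
   vertex determines the colours of its neighbours. The step-N colour of a vertex
   depends only on its ball of radius N. Hence for two paths p, q with the same
   end in G, the descendants of p and q at depth at least N have matching
   colours. Comparing the neighbours of a child, whose children match already,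
   the colours match at its parent as well; as there are no sinks, this climbs up
   to p and q and even to their parents. So the colour of a path and that of its
   parent depend only on the end vertex, which gives l and l_p. *)
From Stdlib Require Import Classical.
Require Import Defs.
From mathcomp Require Import all_boot.
From mathcomp Require Import finmap multiset.

Set Implicit Arguments.
Unset Strict Implicit.
Unset Printing Implicit Defensive.

Lemma prefix_rconsr (T : eqType) (s s' : seq T) y :
  prefix s (rcons s' y) = (s == rcons s' y) || prefix s s'.
Proof.
apply/idP/orP => [/prefixP[u]|[/eqP->|/prefixP[u ->]]].
- case/lastP: u => [|u z]; first by rewrite cats0 => <-; left.
  by rewrite -rcons_cat => /rcons_inj[-> _]; right; apply: prefix_prefix.
- exact: prefix_refl.
- by rewrite rcons_cat prefix_prefix.
Qed.

(** * Isomorphisms of the reversed trees and undirected adjacency *)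

Definition adjacent (G : graph) (v w : VG G) : Prop :=
  exists x, orig x = v /\ term x = w \/ orig x = w /\ term x = v.

Lemma graph_iso_adjacent (G H : graph) : graph_iso G H ->
  exists f : VG G -> VG H, [/\ bijective f,
    (forall v, (exists y, term y = f v) -> exists x, term x = v) &
    forall u v, adjacent (f u) (f v) <-> adjacent u v].
Proof.
case=> f [g [bij_f [g' g'K gK] fo ft]]; have inj_f := bij_inj bij_f.
exists f; split=> // [v [y yfv]|u v].
  by exists (g' y); apply: inj_f; rewrite -ft gK.
split=> -[x Hx]; last first.
  by exists (g x); rewrite fo ft; move: Hx => [[-> ->]|[-> ->]]; tauto.
exists (g' x); rewrite -[x]gK fo ft in Hx.
by case: Hx => -[/inj_f-> /inj_f->]; tauto.
Qed.

Section UnfoldingIso.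

Variables (G : graph) (R : VG G).
Local Notation T := (unfolding R).
Implicit Types (v w : VG T) (x : EG T).

Lemma mem_root_path v x : (x \in root_path v) = prefix (val (term x)) (val v).
Proof.
have := xchooseP (root_path_exists v); rewrite -/(root_path v).
case/andP=> ps /eqP ts.
have Dv := unf_terminus ps; rewrite ts in Dv; rewrite Dv /= {ts Dv}.
move: (root_path v) ps => s.
elim/last_ind: s => [|s y IHs].
  by move=> _; rewrite [LHS]in_nil prefixs0 /=; case: (val (val x).1).
rewrite is_path_rcons => /andP[ps /eqP oy].
have Dy : val (val y).1 = [seq (val z).2 | z <- s].
  by rewrite -[LHS]/(val (orig y)) oy (unf_terminus ps).
by rewrite mem_rcons inE IHs // map_rcons prefix_rconsr -Dy /= eqseq_rcons.
Qed.

Lemma rev_term_neq v (x : EG (reverse_to v)) : term x <> v.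
Proof.
rewrite /=; case: ifP => [|/negP h Dv]; last first.
  by apply: h; rewrite mem_root_path -Dv prefix_refl.
rewrite mem_root_path => /prefixP[s Dv] ov; have := congr1 size Dv.
rewrite -{1}ov /= /unf_orig size_cat size_rcons => /eqP.
by rewrite addSn -addnS -{1}[size _]addn0 eqn_add2l.
Qed.

Lemma unf_edge_to v : val v <> [::] -> exists x, term x = v.
Proof.
case: v => p /= Rp; case/lastP: p Rp => // p e Rpe _.
have := Rpe; rewrite is_path_rcons => /andP[Rp pe].
pose x : EG T := Sub (Sub p Rp : unf_vertex R, e) pe.
by exists x; apply/val_inj.
Qed.

(** If [w] is a proper prefix of [v], the edge leaving [w] towards [v] is reversed and so ends at
    [w]; otherwise the edge from the parent of [w] keeps its direction. *)
Lemma rev_edge_to v w : w <> v -> exists x : EG (reverse_to v), term x = w.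
Proof.
move=> neq_wv; have [/prefixP[s Dv]|npref] := boolP (prefix (val w) (val v)).
  case: s Dv => [|e s] Dv.
    by case: neq_wv; apply/val_inj; rewrite /= Dv cats0.
  have := valP v; rewrite /= Dv is_path_cat /= => /and3P[_ we _].
  pose x : EG T := Sub (w, e) we.
  by exists x; rewrite /= mem_root_path /= Dv -cat_rcons prefix_prefix.
have [|x xw] := @unf_edge_to w; first by move=> w0; rewrite w0 prefix0s in npref.
by exists x; rewrite /= mem_root_path xw (negPf npref).
Qed.

Lemma rev_adjacent u v w :
  adjacent (G := reverse_to u) v w <-> adjacent (G := T) v w.
Proof.
by split=> -[x Hx]; exists x; move: Hx; rewrite /=; case: ifP => _; tauto.
Qed.

(* In T^v the edges point away from v, so v is the only vertex which is not a
   terminus and every isomorphism maps it to w. *)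
Lemma rev_iso_adjacent v w : graph_iso (reverse_to v) (reverse_to w) ->
  exists f : VG T -> VG T, [/\ bijective f, f v = w &
    forall u u', adjacent (f u) (f u') <-> adjacent u u'].
Proof.
case/graph_iso_adjacent=> f [bij_f f_term f_adj]; exists f; split=> // [|u u'].
  apply: NNPP => /rev_edge_to/(f_term v)[x]; exact: rev_term_neq.
apply: iff_trans (rev_adjacent v u u').
exact: iff_trans (iff_sym (rev_adjacent w (f u) (f u'))) (f_adj u u').
Qed.

End UnfoldingIso.

(** Each [x] either satisfies every [P n] or fails from some stage on; the maximum of these finitely
    many stages works. *)
Lemma stabilise (F : finType) (P : nat -> F -> Prop) :
  (forall n x, P n.+1 x -> P n x) -> exists N, forall x, P N x -> P N.+1 x.
Proof.
move=> decP.
have decP' m n x : m <= n -> P n x -> P m x.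
  by move/subnK <-; elim: (n - m) => // k IHk /decP.
suff [N PN] : exists N, forall n, N <= n ->
    {in enum F, forall x, P n x -> P n.+1 x}.
  by exists N => x; apply: PN => //; rewrite mem_enum.
elim: (enum F) => [|x s [N IHs]]; first by exists 0.
have [allP|/not_all_ex_not[m notP]] := classic (forall n, P n x).
  by exists N => n le_Nn y /predU1P[-> _|]; [exact: allP | exact: IHs].
exists (maxn N m) => n; rewrite geq_max => /andP[le_Nn le_mn] y.
by case/predU1P=> [-> /(decP' _ _ _ le_mn)/notP|]; last exact: IHs.
Qed.

(** * Colour refinement on the unfolding tree *)

Section Colour.

Variables (V E : finType) (o t : E -> V) (R : V).
Local Notation G := (Graph o t).
Implicit Types (p q s : seq E) (e : E).

Definition end_of p : V := @terminus G R p.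

Lemma end_of_cat p s : end_of (p ++ s) = @terminus G (end_of p) s.
Proof. by rewrite /end_of terminus_cat. Qed.

Lemma end_of_rcons p e : end_of (rcons p e) = t e.
Proof. by rewrite -cats1 end_of_cat. Qed.

Definition children p : seq (seq E) :=
  [seq rcons p e | e <- enum (out_edges o (end_of p))].

(** The empty path is singled out because [take] would make it its own parent. *)
Definition neighbours p : seq (seq E) :=
  (if p is [::] then [::] else [:: take (size p).-1 p]) ++ children p.

Lemma neighbours_rcons p e :
  neighbours (rcons p e) = p :: children (rcons p e).
Proof.
rewrite /neighbours size_rcons /= -{2}cats1 take_size_cat //.
by case: p.
Qed.

(* Iterated colour refinement of the tree without its orientation. *)
Fixpoint colour n p : nat :=
  if n is m.+1 then
    choice.pickle (colour m p, sort leq [seq colour m q | q <- neighbours p])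
  else 0.

Lemma colourS n p q : colour n.+1 p = colour n.+1 q <->
  colour n p = colour n q /\
  perm_eq [seq colour n p' | p' <- neighbours p]
          [seq colour n q' | q' <- neighbours q].
Proof.
have sortP := perm_sortP leq_total leq_trans anti_leq.
split=> [/(pcan_inj choice.pickleK)[e1 e2]|[e1 /sortP e2]].
  by split=> //; apply/sortP.
by congr (choice.pickle (_, _)).
Qed.

(** Each refinement step climbs at most one edge, so with [n <= size s] the recursion stays below
    [p] and [q], where the two subtrees agree. *)
Lemma colour_cat p q s n : end_of p = end_of q -> n <= size s ->
  colour n (p ++ s) = colour n (q ++ s).
Proof.
move=> e_pq; elim: n s => // n IHn s.
case/lastP: s => // s e; rewrite size_rcons ltnS => le_ns.
apply/colourS; split; first by apply: IHn; rewrite size_rcons leqW.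
rewrite -!rcons_cat !neighbours_rcons /= IHn // perm_cons.
rewrite /children !rcons_cat end_of_cat e_pq -end_of_cat -!map_comp.
rewrite (eq_map (g := colour n \o rcons (q ++ rcons s e)))
  ?perm_refl // => e' /=.
rewrite !rcons_cat; apply: IHn.
by rewrite !size_rcons !leqW.
Qed.

Lemma mem_children p q :
  reflect (exists2 e, o e = end_of p & q = rcons p e) (q \in children p).
Proof.
apply: (iffP mapP) => -[e].
  by rewrite mem_enum inE => /eqP oe ->; exists e.
by move=> oe ->; exists e; rewrite // mem_enum inE oe.
Qed.

Lemma uniq_neighbours p : uniq (neighbours p).
Proof.
have uniq_children q : uniq (children q).
  by rewrite map_inj_uniq ?enum_uniq // => e e' /rcons_inj[].
case/lastP: p => [|p e]; first exact: uniq_children.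
rewrite neighbours_rcons /= uniq_children andbT.
apply/negP => /mem_children[e' _ /(congr1 size)/eqP].
by rewrite !size_rcons -addn2 -{1}[size p]addn0 eqn_add2l.
Qed.

Local Notation T := (@unfolding G R).

Lemma path_neighbours p q :
  is_path (G := G) R p -> q \in neighbours p -> is_path (G := G) R q.
Proof.
have path_child p' : is_path (G := G) R p' -> q \in children p' ->
    is_path (G := G) R q.
  by move=> Rp' /mem_children[e oe ->]; rewrite is_path_rcons Rp' /= oe eqxx.
case/lastP: p => [|p e] Rp; first exact: path_child.
rewrite neighbours_rcons inE => /predU1P[->|]; last exact: path_child.
by move: Rp; rewrite is_path_rcons => /andP[].
Qed.

Lemma adjacentE (u v : VG T) : adjacent u v <-> val v \in neighbours (val u).
Proof.
split=> [[x []] [<- <-]|].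
- rewrite /neighbours mem_cat; apply/orP; right; apply/mem_children.
  by exists (val x).2 => //; apply/eqP/(valP x).
- by rewrite neighbours_rcons mem_head.
have child : val v \in children (val u) -> adjacent u v.
  move=> /mem_children[e oe Dv].
  have ue : orig (g := G) e == @terminus G R (val u) by apply/eqP.
  pose x : EG T := Sub (u, e) ue.
  by exists x; left; split=> //; apply/val_inj.
have [Du|/eqP/(@unf_edge_to G R)[x Du]] := eqVneq (val u) [::].
  by move: child; rewrite Du.
rewrite -Du neighbours_rcons inE => /predU1P[/val_inj Dv|Dv].
  by exists x; right.
by rewrite Du; apply: child; rewrite -Du.
Qed.

Lemma colour_iso (v w : VG T) n :
  graph_iso (reverse_to v) (reverse_to w) ->
  colour n (val v) = colour n (val w).
Proof.
case/rev_iso_adjacent=> f [bij_f <- f_adj]; have inj_f := bij_inj bij_f.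
(* [neighbours] lists bare edge sequences while [f] acts on tree vertices, so the lists are lifted
   along [insub]. *)
pose nbs (u : VG T) : seq (VG T) := pmap insub (neighbours (val u)).
have mem_nbs u u' : (u' \in nbs u) = (val u' \in neighbours (val u)).
  by rewrite mem_pmap_sub.
have val_nbs u : [seq val u' | u' <- nbs u] = neighbours (val u).
  rewrite pmap_filter; last exact: insubK.
  apply/all_filterP/allP => p /(path_neighbours (valP u)) Rp.
  by rewrite /= insubT.
have uniq_nbs u : uniq (nbs u) by rewrite pmap_sub_uniq ?uniq_neighbours.
have perm_nbs u : perm_eq [seq f u' | u' <- nbs u] (nbs (f u)).
  apply: uniq_perm => [||u']; rewrite ?map_inj_uniq //.
  have [g fK gK] := bij_f; rewrite -[u']gK mem_map // !mem_nbs.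
  by apply/idP/idP; move/adjacentE=> H; apply/adjacentE/f_adj.
elim: n v => // n IHn u; apply/colourS; split; first exact: IHn.
rewrite -!val_nbs -!map_comp; apply: seq.perm_trans (perm_map _ (perm_nbs u)).
by rewrite -map_comp (eq_map (_ : _ =1 colour n \o val \o f)) //.
Qed.

Definition equitable N := forall p q, is_path (G := G) R p ->
  is_path (G := G) R q -> colour N p = colour N q ->
  perm_eq [seq colour N p' | p' <- neighbours p]
          [seq colour N q' | q' <- neighbours q].

(* The colourings get finer with N and never separate two vertices with the same
   label, so they stabilise. *)
Lemma cocompact_equitable : cocompact T -> exists N, equitable N.
Proof.
case=> F [l lP].
(* Stabilisation is applied to pairs of labels, which are finite in number, unlike pairs of
   vertices. *)
pose P n (a : F * F) := exists v w : VG T,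
  [/\ l v = a.1, l w = a.2 & colour n (val v) = colour n (val w)].
have [|N PN] := @stabilise _ P.
  by move=> n a [v [w [lv lw /colourS[e _]]]]; exists v, w.
exists N => p q Rp Rq e_pq; pose v : VG T := Sub p Rp; pose w : VG T := Sub q Rq.
have [|v' [w' [/lP lv /lP lw e_vw]]] := PN (l v, l w); first by exists v, w.
have /colourS[] // : colour N.+1 p = colour N.+1 q.
by rewrite -[p]/(val v) -[q]/(val w) -(colour_iso _ lv) e_vw (colour_iso _ lw).
Qed.

(** * Stable colours are determined by end vertices *)

Section Equitable.

Variable N : nat.
Hypothesis equitN : equitable N.
Hypothesis G_sinkless : sinkless G.

(** The colours of the children cancel from the two neighbour multisets equated by [equitN], leaving
    one parent colour on each side. *)
Lemma colour_parent p q e e' :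
  is_path (G := G) R (rcons p e) -> is_path (G := G) R (rcons q e') ->
  t e = t e' -> colour N (rcons p e) = colour N (rcons q e') ->
  (forall e1, o e1 = t e -> colour N (rcons (rcons p e) e1)
                          = colour N (rcons (rcons q e') e1)) ->
  colour N p = colour N q.
Proof.
move=> Rpe Rqe te c_pq c_child; have := equitN Rpe Rqe c_pq.
rewrite !neighbours_rcons /children !end_of_rcons -te /= -!map_comp.
have /eq_in_map-> : {in enum (out_edges o (t e)),
    colour N \o rcons (rcons p e) =1 colour N \o rcons (rcons q e')}.
  by move=> e1; rewrite mem_enum inE => /eqP/c_child.
rewrite -cat1s -[X in perm_eq _ X]cat1s perm_cat2r.
by case/(perm_small_eq (s2 := [:: _]) isT).
Qed.

(* Deep below p and q the colours agree because they only depend on the subtrees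
   hanging there, and the agreement climbs up to p and q by colour_parent. *)
Lemma colour_same_end p q s : is_path (G := G) R p -> is_path (G := G) R q ->
  end_of p = end_of q -> is_path (G := G) (end_of p) s ->
  colour N (p ++ s) = colour N (q ++ s).
Proof.
(* Induction on [k], a bound on how far [s] falls short of depth [N]. *)
move=> Rp Rq e_pq; have [k] : exists k, N <= size s + k.
  by exists N; rewrite leq_addl.
elim: k s => [|k IHk] s; first by rewrite addn0 => /(colour_cat e_pq).
rewrite addnS -addSn => le_Ns ps.
have [e oe] := G_sinkless (@terminus G (end_of p) s).
have pse : is_path (G := G) (end_of p) (rcons s e).
  by rewrite is_path_rcons ps; apply/eqP.
apply: (@colour_parent _ _ e e) => //; rewrite ?rcons_cat.
- by rewrite is_path_cat Rp.
- by rewrite is_path_cat Rq -[@terminus G R q]/(end_of q) -e_pq.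
- by apply: IHk; rewrite ?size_rcons.
move=> e1 oe1; rewrite !rcons_cat; apply: IHk; first by rewrite !size_rcons ltnW.
by rewrite is_path_rcons pse -cats1 terminus_cat; apply/eqP.
Qed.

Lemma colour_path p q : is_path (G := G) R p -> is_path (G := G) R q ->
  end_of p = end_of q -> colour N p = colour N q.
Proof.
by move=> Rp Rq e_pq; have := @colour_same_end p q [::]; rewrite !cats0; apply.
Qed.

Lemma colour_parent_path p q e e' :
  is_path (G := G) R (rcons p e) -> is_path (G := G) R (rcons q e') ->
  t e = t e' -> colour N p = colour N q.
Proof.
move=> Rpe Rqe te; apply: (colour_parent Rpe Rqe) => // [|e1 oe1].
  by apply: colour_path; rewrite ?end_of_rcons.
rewrite -![rcons (rcons _ _) e1]cats1; apply: colour_same_end => //=.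
  by rewrite !end_of_rcons.
by rewrite end_of_rcons oe1 eqxx.
Qed.

End Equitable.

End Colour.

(** * From stable colours to the labelling *)

Lemma mset1DK (K : choiceType) (a : K) (A : {mset K}%mset) :
  ((a +` A) `\ a)%mset = A.
Proof. by apply/msetP => b; rewrite msetB1E mset1DE addKn. Qed.

Lemma mset_map_seq (A B : choiceType) (f : A -> B) s :
  mset_map f (seq_mset s) = seq_mset [seq f x | x <- s].
Proof. by apply/eq_seq_msetP/perm_map/perm_eq_seq_mset. Qed.

Theorem theorem1p2 (V E : finType) (o t : E -> V) (R : V)
    (G_rooted : rooted (G := Graph o t) R)
    (G_sinkless : sinkless (Graph o t))
    (no_in_R : forall e : E, t e <> R)
    (out_R : 2 < #|out_edges o R|) :
  cocompact (unfolding (G := Graph o t) R) -> admits_actual_labelling o t R.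
Proof.
move=> /cocompact_equitable[N equitN].
pose path (v : V) : seq E := xchoose (G_rooted v).
have pathP v : is_path (G := Graph o t) R (path v).
  by have /andP[] := xchooseP (G_rooted v).
have end_path v : end_of o t R (path v) = v.
  by have /andP[_ /eqP] := xchooseP (G_rooted v).
pose c := colour o t R N.
(* The label set is [V] itself: a colour is named by a chosen vertex [w] whose [path w] has it. The
   default [R] only arises for colours of no [path w]. *)
pose rep k := odflt R [pick w | c (path w) == k].
pose l v := rep (c (path v)).
pose neighbour_labels v := [seq rep (c p) | p <- neighbours o t R (path v)].
have c_l v : c (path (l v)) = c (path v).
  by rewrite /l /rep; case: pickP => [w /eqP //|/(_ v)]; rewrite eqxx.
have l_end p : is_path (G := Graph o t) R p -> rep (c p) = l (end_of o t R p).
  by move=> Rp; congr rep; apply: (colour_path equitN).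
(* The multisets are read at the representative [l v]; equitability carries them back to [v]. *)
have M_l v : seq_mset (neighbour_labels (l v)) = seq_mset (neighbour_labels v).
  apply/eq_seq_msetP; rewrite /neighbour_labels !(map_comp rep c).
  exact: perm_map (equitN _ _ (pathP _) (pathP _) (c_l v)).
have out_l v : mset_map l (out_neighbours o t v) =
    seq_mset [seq rep (c p) | p <- children o t R (path v)].
  rewrite mset_map_seq /children end_path -!map_comp; congr seq_mset.
  apply/eq_in_map => e; rewrite mem_enum inE => /eqP oe /=.
  rewrite l_end ?end_of_rcons // is_path_rcons pathP /=.
  by apply/eqP; rewrite -[RHS]/(end_of o t R (path v)) end_path.
pose parent v := take (size (path v)).-1 (path v).
exists V, l, (fun v => rep (c (parent (val v)))),
  (fun x => seq_mset (neighbour_labels x)).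
split=> [[v neq_vR] /=|]; last first.
  rewrite M_l out_l /neighbour_labels; congr seq_mset.
  (* No edge enters [R], so its chosen path is empty and its only neighbours are children. *)
  have := end_path R; case/lastP: (path R) => // p e.
  by rewrite end_of_rcons => /no_in_R.
rewrite M_l out_l /neighbour_labels /parent.
have := pathP v; have := end_path v; case/lastP: (path v) => [Dv|p e].
  by rewrite -Dv eqxx in neq_vR.
rewrite end_of_rcons neighbours_rcons => te Rpe.
have -> : take (size (rcons p e)).-1 (rcons p e) = p.
  by rewrite size_rcons -cats1 take_size_cat.
rewrite /= mset_cons; split.
- by rewrite in_mset1D eqxx.
- by rewrite mset1DK.
(* The chosen path to [o e'], extended by [e'], also ends at [v], so its parent has the same colour
   as [p]. *)
move=> e' te'; congr rep.
apply: (@colour_parent_path _ _ _ _ _ _ equitN G_sinkless _ _ e' e) => //.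
  by rewrite is_path_rcons pathP; apply/eqP; rewrite -[RHS]/(end_of o t R _)
    end_path.
by rewrite te te'.
Qed.
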